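(* Let $E_1, E_2$ be Banach spaces and let $\mathcal{A}_1, \mathcal{A}_2$ be standard subalgebras of $B(E_1)$ and of $B(E_2)$, respectively. If $T:\mathcal{A}_1\rightarrow\mathcal{A}_2$ is a biseparating map, then $T$ is continuous and of the form $$T(A)=\alpha\, S\circ A\circ S^{-1},\quad\text{for all } A\in\mathcal{A}_1,$$ where $S$ is a continuous linear isomorphism from $E_1$ onto $E_2$ and $\alpha$ is a nonzero scalar.
   Context: Scalars are real or complex (the result is stated for both cases, with the same scalar field for both spaces). For a Banach space $E$, $B(E)$ is the algebra of all continuous linear maps from $E$ to $E$, with the operator norm and with composition as product. A subalgebra $\mathcal{A}$ of $B(E)$ is called standard if it contains all finite-dimensional operators (i.e. all continuous finite-rank operators on $E$) and the identity operator $Id$; it is not assumed to be closed in the norm topology. Subalgebras of $B(E)$ carry the operator norm topology. A linear map $T$ between algebras $\mathcal{A}$ and $\mathcal{B}$ is called separating if $ab=0$ implies $T(a)T(b)=0$ for all $a,b\in\mathcal{A}$; it is called biseparating if it is separating, $T^{-1}:\mathcal{B}\rightarrow\mathcal{A}$ exists (so $T$ is a linear bijection), and $T^{-1}$ is also separating. *)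

(* Defs.v *)
From HB Require Import structures.
From mathcomp Require Import all_boot all_order all_algebra.
From mathcomp Require Import complex.
From mathcomp Require Import boolp classical_sets functions reals.
From mathcomp Require Import topology normedtype.

Set Implicit Arguments.
Unset Strict Implicit.
Unset Printing Implicit Defensive.

Import Order.TTheory GRing.Theory Num.Theory.
Import numFieldNormedType.Exports.

Local Open Scope classical_set_scope.
Local Open Scope ring_scope.

Variant real_or_complex : numFieldType -> Prop :=
  | RealScalars (R : realType) : real_or_complex R
  | ComplexScalars (R : realType) : real_or_complex R[i].

Section Operators.
Variables (K : numFieldType) (E : completeNormedModType K).

(* B(E), inside the K-module of all functions E -> E. *)
Definition bounded_ops : set (E -> E) := [set f | linear f /\ continuous f].

(* The supremum is taken in the partial order of K. Over the complex numbers
   norms are nonnegative reals and every upper bound of a nonempty set of them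
   is real, so this is the usual real supremum. *)
Definition opnorm (f : E -> E) : K :=
  supremum 0 [set `|f x| | x in [set x : E | `|x| <= 1]].

Definition finite_rank (f : E -> E) : Prop :=
  exists (n : nat) (v : 'I_n -> E),
    forall x, exists c : 'I_n -> K, f x = \sum_(i < n) c i *: v i.

Definition subalgebra (A : set (E -> E)) : Prop :=
  [/\ A `<=` bounded_ops,
      A 0,
      forall (a : K) f g, A f -> A g -> A (a *: f + g)
    & forall f g, A f -> A g -> A (f \o g)].

Definition standard_subalgebra (A : set (E -> E)) : Prop :=
  [/\ subalgebra A,
      forall f, bounded_ops f -> finite_rank f -> A f
    & A idfun].

End Operators.

(* A map A1 -> A2 is encoded as a function T on the ambient function spaces,
   of which only the values on A1 matter. *)
Section Maps.
Variables (K : numFieldType) (E1 E2 : completeNormedModType K).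
Variables (A1 : set (E1 -> E1)) (A2 : set (E2 -> E2)).
Variable T : (E1 -> E1) -> (E2 -> E2).

Definition separating : Prop :=
  [/\ forall f, A1 f -> A2 (T f),
      forall (a : K) f g, A1 f -> A1 g -> T (a *: f + g) = a *: T f + T g
    & forall f g, A1 f -> A1 g -> f \o g = 0 -> T f \o T g = 0].

Definition opnorm_continuous : Prop :=
  forall f, A1 f -> forall e : K, 0 < e -> exists2 d : K, 0 < d &
    forall g, A1 g -> opnorm (g - f) < d -> opnorm (T g - T f) < e.

End Maps.

Definition biseparating (K : numFieldType) (E1 E2 : completeNormedModType K)
    (A1 : set (E1 -> E1)) (A2 : set (E2 -> E2))
    (T : (E1 -> E1) -> (E2 -> E2)) : Prop :=
  separating A1 A2 T /\
  exists Tinv : (E2 -> E2) -> (E1 -> E1),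
    [/\ forall f, A1 f -> Tinv (T f) = f,
        forall g, A2 g -> T (Tinv g) = g
      & separating A2 A1 Tinv].

(* Main.v *)
(* For an idempotent p, both ap(c - pc) and (a - ap)pc vanish, so a separating
   map satisfies T(ap) T(c) = T(a) T(pc). Rank one operators are combinations
   of idempotents, hence the same holds with p replaced by any rank one b; with
   a or c the identity this makes T(id) commute with enough rank one operators
   to be a scalar alpha, and gives T(a) T(b) = alpha T(ab). Then, for a fixed
   functional f and a suitable vector w, S x = T(x (x) f) w satisfies
   T(a) S = alpha S a, and T(a) = alpha S a S^-1 once S is seen to be bijective.
   As T maps into bounded operators in both directions, g o S is continuous for
   every continuous functional g, which forces S to be bounded. *)
Require Import Defs.
From HB Require Import structures.
From mathcomp Require Import all_boot all_order all_algebra.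
From mathcomp Require Import ring lra complex.
From mathcomp Require Import boolp classical_sets functions reals.
From mathcomp Require Import topology normedtype.

Set Implicit Arguments.
Unset Strict Implicit.
Unset Printing Implicit Defensive.

Import Order.TTheory GRing.Theory Num.Theory.
Import numFieldNormedType.Exports.
Local Open Scope classical_set_scope.
Local Open Scope ring_scope.

(** * The Hahn-Banach theorem for sublinear functionals on a real vector space *)

Section HahnBanach.
Variables (R : realType) (V : lmodType R).
Implicit Types (p q : V -> R) (u v : V).

Definition sublinear p : Prop :=
  (forall u v, p (u + v) <= p u + p v) /\
  (forall (a : R) v, 0 < a -> p (a *: v) <= a * p v).

Lemma sublinear0 p : sublinear p -> p 0 = 0.
Proof.
move=> [pD pZ]; have := pD 0 0; rewrite addr0 => p00.
by have := pZ 2^-1 0 (ltac:(lra)); rewrite scaler0 => h0; lra.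
Qed.

Lemma sublinearZ p a v : sublinear p -> 0 <= a -> p (a *: v) = a * p v.
Proof.
move=> sp; rewrite le_eqVlt => /orP[/eqP<-|a0].
  by rewrite scale0r sublinear0// mul0r.
have [_ pZ] := sp; apply/eqP; rewrite eq_le pZ//= -ler_pdivlMl//.
by rewrite -{1}[v](scalerK (lt0r_neq0 a0)) pZ ?invr_gt0.
Qed.

Lemma sublinear_opp_le p v : sublinear p -> - p (- v) <= p v.
Proof.
by move=> sp; have := sp.1 v (- v); rewrite subrr sublinear0 => // h; lra.
Qed.

(** Serves twice: for infima along a ray and for infima over a chain in Zorn's lemma. *)
Lemma sublinear_inf (P : V -> set R) :
  (forall v, P v !=set0) -> (forall v, has_lbound (P v)) ->
  (forall u v x y, P u x -> P v y -> exists2 z, P (u + v) z & z <= x + y) ->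
  (forall (a : R) v x, 0 < a -> P v x ->
    exists2 z, P (a *: v) z & z <= a * x) ->
  sublinear (fun v => inf (P v)).
Proof.
move=> P0 Plb PD PZ; split=> [u v|a v a0].
  rewrite -lerBlDr; apply: lb_le_inf => // x Px.
  rewrite lerBlDr -lerBlDl; apply: lb_le_inf => // y Py.
  have [z Pz zxy] := PD _ _ _ _ Px Py.
  by rewrite lerBlDl (le_trans _ zxy)// ge_inf.
rewrite -ler_pdivrMl//; apply: lb_le_inf => // x Px.
have [z Pz zx] := PZ _ _ _ a0 Px.
by rewrite ler_pdivrMl// (le_trans _ zx)// ge_inf.
Qed.

(* The values whose infimum over t >= 0 gives the largest sublinear functional
   below p that is linear along the ray spanned by u. *)
Definition ray_values p u v : set R :=
  [set p (v + t *: u) - t * p u | t in [set t : R | 0 <= t]].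

Lemma ray_values_lbound p u v : sublinear p -> has_lbound (ray_values p u v).
Proof.
move=> sp; exists (- p (- v)) => _ [t /= t0 <-].
have := sp.1 (v + t *: u) (- v).
by rewrite addrAC subrr add0r sublinearZ// => ?; lra.
Qed.

Definition ray_inf p u v : R := inf (ray_values p u v).

Lemma ray_inf_le p u v t : sublinear p -> 0 <= t ->
  ray_inf p u v <= p (v + t *: u) - t * p u.
Proof. by move=> sp t0; apply: ge_inf; [exact: ray_values_lbound|exists t]. Qed.

Lemma ray_inf_le0 p u v : sublinear p -> ray_inf p u v <= p v.
Proof.
move=> sp; have := ray_inf_le u v sp (lexx 0).
by rewrite scale0r addr0 mul0r subr0.
Qed.

Lemma sublinear_ray_inf p u : sublinear p -> sublinear (ray_inf p u).
Proof.
move=> sp; apply: sublinear_inf.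
- by move=> v; exists (p (v + 0 *: u) - 0 * p u), 0 => //=.
- by move=> v; exact: ray_values_lbound.
- move=> x y _ _ [s /= s0 <-] [t /= t0 <-].
  exists (p (x + y + (s + t) *: u) - (s + t) * p u).
    by exists (s + t) => //=; exact: addr_ge0.
  by rewrite scalerDl addrACA mulrDl opprD [leRHS]addrACA lerD2r; exact: sp.1.
- move=> a v _ a0 [t /= t0 <-].
  exists (p (a *: v + (a * t) *: u) - a * t * p u).
    by exists (a * t) => //=; apply: mulr_ge0 => //; exact: ltW.
  by rewrite -scalerA -scalerDr (sublinearZ _ sp (ltW a0)) -mulrA mulrBr.
Qed.

(** Zorn's lemma for the reversed pointwise order. A chain is bounded by its pointwise infimum,
    which is finite because sublinear functionals below [p] are at least [- p (- v)] at [v]. *)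
Lemma minimal_sublinear p : sublinear p ->
  exists q, [/\ sublinear q, forall v, q v <= p v
    & forall q', sublinear q' -> (forall v, q' v <= q v) -> q' = q].
Proof.
move=> sp; pose S := {q | sublinear q /\ forall v, q v <= p v}.
pose p0 : S := exist _ p (conj sp (fun v => lexx (p v))).
pose le (q r : S) := `[< forall v, sval r v <= sval q v >].
have [| | |[q [sq qp]] qmin] := @ZL_preorder S p0 le.
- by move=> q; apply/asboolP.
- move=> r s t /asboolP rs /asboolP st; apply/asboolP => v.
  exact: le_trans (st v) (rs v).
(* Adjoining [p] keeps the sets of values nonempty when the chain is empty. *)
- move=> A chainA; pose B := A `|` [set p0].
  have chainB r s : B r -> B s -> (le r s) \/ (le s r).
    move=> [Ar|->] [As|->]; first exact: chainA.
    + by right; apply/asboolP => v; exact: (svalP r).2.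
    + by left; apply/asboolP => v; exact: (svalP s).2.
    + by left; apply/asboolP.
  pose P v : set R := [set sval q v | q in B].
  have Plb v : has_lbound (P v).
    exists (- p (- v)) => _ [[q [sq qp]] /= _ <-].
    by rewrite (le_trans _ (sublinear_opp_le _ sq))// lerN2.
  have sP : sublinear (fun v => inf (P v)).
    apply: sublinear_inf => //.
    + by move=> v; exists (p v), p0 => //; right.
    + move=> u v _ _ [r Br <-] [s Bs <-].
      have [/asboolP rs|/asboolP sr] := chainB _ _ Br Bs.
      * exists (sval s (u + v)); first by exists s.
        by rewrite (le_trans ((svalP s).1.1 u v))// lerD2r.
      * exists (sval r (u + v)); first by exists r.
        by rewrite (le_trans ((svalP r).1.1 u v))// lerD2l.
    + move=> a v _ a0 [r Br <-]; exists (sval r (a *: v)); first by exists r.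
      exact: (svalP r).1.2.
  have infle r v : B r -> inf (P v) <= sval r v.
    by move=> Br; apply: ge_inf => //; exists r.
  have Pp v : inf (P v) <= p v by apply: (infle p0); right.
  exists (exist _ (fun v => inf (P v)) (conj sP Pp)) => r Ar.
  by apply/asboolP => v /=; apply: infle; left.
exists q; split=> // q' sq' q'q.
have q'p v : q' v <= p v by exact: le_trans (q'q v) (qp v).
have /asboolP qq' := qmin (exist _ q' (conj sq' q'p)) (asboolT q'q).
by apply/funext => v; apply/eqP; rewrite eq_le q'q qq'.
Qed.

(** A minimal [q] is linear: [ray_inf q u] is sublinear and below [q], hence equal to it, and its
    term at [t = 1] makes [q] superadditive. *)
Lemma hahn_banach_sublinear p : sublinear p ->
  exists f : {linear V -> R^o}, forall v, f v <= p v.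
Proof.
move=> /minimal_sublinear[q [sq qp qmin]].
have qr u v : q u + q v <= q (v + u).
  have := qmin _ (sublinear_ray_inf u sq) (fun w => ray_inf_le0 u w sq).
  move=> /(congr1 (@^~ v)) <-.
  by have := ray_inf_le u v sq ler01; rewrite scale1r mul1r; lra.
have qD u v : q (u + v) = q u + q v.
  by apply/eqP; rewrite eq_le sq.1/= addrC qr.
have qN v : q (- v) = - q v.
  by have := qD v (- v); rewrite subrr sublinear0// => h; lra.
have qZ a v : q (a *: v) = a * q v.
  have [a0|/ltW a0] := leP 0 a; first exact: sublinearZ.
  by rewrite -{1}[a]opprK scaleNr qN sublinearZ ?oppr_ge0// mulNr opprK.
have lq : linear (q : V -> R^o) by move=> a u v; rewrite qD qZ.
pose f : {linear V -> R^o} := HB.pack q (GRing.isLinear.Build _ _ _ _ q lq).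
by exists f.
Qed.

(** A linear functional below [ray_inf p y] is at most [- p y] at [- y], since the term at [t = 1]
    there is [p 0 - p y]. *)
Lemma hahn_banach_attained p y : sublinear p ->
  exists2 f : {linear V -> R^o}, (forall v, f v <= p v) & f y = p y.
Proof.
move=> sp; have [f fp] := hahn_banach_sublinear (sublinear_ray_inf y sp).
exists f => [v|]; first exact: le_trans (fp v) (ray_inf_le0 _ _ sp).
apply/eqP; rewrite eq_le (le_trans (fp y) (ray_inf_le0 _ _ sp))//=.
have := fp (- y); rewrite linearN/= => fNy.
have := ray_inf_le y (- y) sp ler01.
by rewrite scale1r addNr sublinear0// mul1r => ?; lra.
Qed.

End HahnBanach.

(** * Complex functionals from real ones *)

Section RestrictionOfScalars.
Local Open Scope complex_scope.
Variables (R : realType) (V : lmodType R[i]).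

Definition restriction_of_scalars : Type := V.
HB.instance Definition _ := GRing.Zmodule.on restriction_of_scalars.

Let scale (a : R) (v : restriction_of_scalars) : restriction_of_scalars :=
  a%:C *: (v : V).

Fact restriction_scaleA a b v : scale a (scale b v) = scale (a * b) v.
Proof. by rewrite /scale scalerA rmorphM. Qed.

Fact restriction_scale1 : left_id 1 scale.
Proof. by move=> v; rewrite /scale rmorph1 scale1r. Qed.

Fact restriction_scaleDr : right_distributive scale +%R.
Proof. by move=> a u v; rewrite /scale scalerDr. Qed.

Fact restriction_scaleDl v : {morph scale^~ v : a b / a + b}.
Proof. by move=> a b; rewrite /scale rmorphD scalerDl. Qed.

HB.instance Definition _ := GRing.Zmodule_isLmodule.Build R
  restriction_of_scalars restriction_scaleA restriction_scale1
  restriction_scaleDr restriction_scaleDl.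

Lemma complex_linear_extension (f : {linear restriction_of_scalars -> R^o}) :
  linear ((fun v : V => f v +i* (- f ('i *: v))) : V -> R[i]^o).
Proof.
have fD (u v : V) : f (u + v) = f u + f v by exact: (linearD f).
have fZ (a : R) (v : V) : f (a%:C *: v) = a * f v by exact: (linearZ_LR f).
move=> [a b] u v.
have -> : 'i *: ((a +i* b) *: u + v) =
    (- b)%:C *: u + a%:C *: ('i *: u) + 'i *: v.
  by rewrite scalerDr !scalerA -scalerDl; congr (_ *: u + _); simpc.
have -> : (a +i* b) *: u = a%:C *: u + b%:C *: ('i *: u).
  by rewrite scalerA -scalerDl; congr (_ *: u); simpc.
rewrite !fD !fZ.
by apply/eqP; rewrite eq_complex /=; apply/andP; split; apply/eqP; ring.
Qed.

End RestrictionOfScalars.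

(** * Norming functionals over both scalar fields *)

Lemma real_norming_functional (R : realType) (E : normedModType R) (y : E) :
  exists2 g : {linear E -> R^o}, (forall v, `|g v| <= `|v|) & `|g y| = `|y|.
Proof.
have sn : sublinear (fun v : E => `|v|).
  by split=> [u v|a v a0]; rewrite ?ler_normD// normrZ gtr0_norm.
have [f fn fy] := hahn_banach_attained y sn.
exists f => [v|]; last by rewrite fy normr_id.
by rewrite ler_norml fn andbT lerNl -linearN (le_trans (fn _))// normrN.
Qed.

Lemma complex_norming_functional (R : realType) (E : normedModType R[i])
    (y : E) :
  exists2 g : {linear E -> R[i]^o}, (forall v, `|g v| <= `|v|) & `|g y| = `|y|.
Proof.
(* The norm of [E] takes values in [R[i]]; its real part is the real sublinear functional that
   Hahn-Banach needs. *)
pose p (v : restriction_of_scalars E) : R := complex.Re `|v : E|.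
have pE (v : E) : `|v| = (p v)%:C%C.
  have := normr_ge0 v; rewrite lecE /p => /andP[/eqP i0 _].
  by case: `|v| i0 => a b /= ->.
have sp : sublinear p.
  split=> [u v|a v a0].
    by have := ler_normD (u : E) (v : E); rewrite !pE -rmorphD lecR.
  have := normrZ a%:C%C (v : E).
  rewrite !pE normc_def /= expr0n/= addr0 sqrtr_sqr gtr0_norm// -rmorphM.
  by move=> /complexI ->.
have [f fp fy] := hahn_banach_attained (y : restriction_of_scalars E) sp.
pose g : {linear E -> R[i]^o} := HB.pack
  (fun v : E => f v +i* (- f ('i *: v)))%C
  (GRing.isLinear.Build _ _ _ _ _ (complex_linear_extension f)).
have gle v : `|g v| <= `|v|.
  have [->|gv0] := eqVneq (g v) 0; first by rewrite normr0.
  (* rotate [v] so that [g] takes a nonnegative real value *)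
  pose c : R[i] := `|g v| / g v.
  have c1 : `|c| = 1 by rewrite normrM normfV normr_id divff// normr_eq0.
  have gc : g (c *: v) = `|g v| by rewrite linearZ/= /GRing.scale/= /c divfK.
  have : complex.Re (g (c *: v)) <= p (c *: v) by exact: fp.
  by rewrite gc -lecR -pE normrZ c1 mul1r.
exists g => //; apply/eqP; rewrite eq_le gle/=.
(* [f y] is the real part of [g y], so it is at most the modulus of [g y]. *)
rewrite pE -fy; apply: le_trans (normc_ge_Re (g y)); rewrite lecR /=.
exact: ler_norm.
Qed.

Lemma norming_functional (K : numFieldType) (hK : real_or_complex K)
    (E : normedModType K) (y : E) :
  exists2 g : {linear E -> K^o}, (forall v, `|g v| <= `|v|) & `|g y| = `|y|.
Proof.
by case: hK E y => R E y;
  [exact: real_norming_functional|exact: complex_norming_functional].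
Qed.

(** * Archimedean property and suprema in the scalar field *)

Lemma scalar_archimedean (K : numFieldType) (hK : real_or_complex K) (x : K) :
  0 <= x -> exists n : nat, x < n%:R.
Proof.
case: hK x => R x; first by exists (Num.truncn x).+1; exact: truncnS_gt.
case: x => a b; rewrite lecE /= => /andP[/eqP-> _].
exists (Num.truncn a).+1; rewrite -(rmorph_nat (real_complex R)) ltcR.
exact: truncnS_gt.
Qed.

(** Comparable complex numbers have equal imaginary parts, so the elements and the upper bounds are
    all real and the supremum of the real parts works. *)
Lemma nonneg_supremum (K : numFieldType) (hK : real_or_complex K) (A : set K) :
  A !=set0 -> (forall x, A x -> 0 <= x) -> has_ubound A -> supremums A !=set0.
Proof.
case: hK A => R A A0 Age0 [M AM].
  exists (sup A); split=> [x Ax|y Ay]; last exact: ge_sup.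
  by apply: ub_le_sup => //; exists M.
have Aim x : A x -> (complex.Re x)%:C%C = x.
  by move=> /Age0; rewrite lecE; case: x => a b /= /andP[/eqP->].
pose B := [set complex.Re x | x in A].
have [x0 Ax0] := A0.
have leM y x : ubound A y -> A x -> complex.Re x <= complex.Re y.
  by move=> yA /yA; rewrite lecE => /andP[].
have ubIm y : ubound A y -> (complex.Re y)%:C%C = y.
  move=> yA; have := yA _ Ax0; rewrite -(Aim _ Ax0) lecE /= => /andP[/eqP].
  by case: y {yA} => a b /= ->.
exists (sup B)%:C%C; split=> [x Ax|y Ay].
  rewrite -(Aim _ Ax) lecR; apply: ub_le_sup; last by exists x.
  by exists (complex.Re M) => _ [z Az <-]; exact: leM.
rewrite -(ubIm _ Ay) lecR; apply: ge_sup; first by exists (complex.Re x0), x0.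
by move=> _ [z Az <-]; exact: leM.
Qed.

(** * Bounded linear maps and the operator norm *)

Lemma continuous_linear_bound (K : numFieldType) (V W : normedModType K)
    (f : {linear V -> W}) :
  continuous f <-> exists2 C, 0 < C & forall x, `|f x| <= C * `|x|.
Proof.
split=> [/linear_bounded_continuous/linear_boundedP/pinfty_ex_gt0[C C0 fC]|].
  by exists C.
move=> [C C0 fC]; apply/linear_bounded_continuous/linear_boundedP.
near=> r => x; apply: le_trans (fC x) _; rewrite ler_wpM2r//.
by near: r; apply: nbhs_pinfty_ge; exact: gtr0_real.
Unshelve. all: by end_near. Qed.

Section OperatorNorm.
Variables (K : numFieldType) (hK : real_or_complex K).
Variable E : completeNormedModType K.
Implicit Types f : E -> E.

Lemma bounded_opsP f : bounded_ops f -> exists2 g : {linear E -> E},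
  f = g & continuous g.
Proof.
move=> [lf cf].
by exists (HB.pack_for {linear E -> E} f (GRing.isLinear.Build _ _ _ _ _ lf)).
Qed.

Lemma bounded_ops_bound f : bounded_ops f ->
  exists2 C, 0 < C & forall x, `|f x| <= C * `|x|.
Proof. by move=> /bounded_opsP[g -> /continuous_linear_bound]. Qed.

Lemma opnorm_supremum f : bounded_ops f ->
  supremums [set `|f x| | x in [set x : E | `|x| <= 1]] (opnorm f).
Proof.
move=> bf; rewrite /opnorm /supremum.
set A := [set _ | _ in _].
have A0 : A !=set0 by exists `|f 0|, 0 => //=; rewrite normr0.
(* [supremum] falls back to [0] on an empty set or when no supremum exists; both cases are
   excluded. *)
rewrite ifF; last by apply/negbTE/set0P.
have [s As] : supremums A !=set0.
  apply: nonneg_supremum => //; first by move=> _ [x _ <-].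
  have [C C0 fC] := bounded_ops_bound bf.
  exists C => _ [x /= x1 <-]; rewrite (le_trans (fC x))//.
  by rewrite -[leRHS]mulr1 ler_wpM2l// ltW.
exact: (xgetPex 0 (ex_intro _ s As)).
Qed.

Lemma opnorm_bound f x : bounded_ops f -> `|f x| <= opnorm f * `|x|.
Proof.
move=> bf; have [g fg _] := bounded_opsP bf; have [ub _] := opnorm_supremum bf.
have [->|x0] := eqVneq x 0; first by rewrite fg raddf0 !normr0 mulr0.
have nx : 0 < `|x| by rewrite normr_gt0.
have /ub : [set `|f x| | x in [set x : E | `|x| <= 1]] `|f (`|x|^-1 *: x)|.
  by exists (`|x|^-1 *: x) => //=; rewrite normrZ normfV normr_id mulVf ?gt_eqF.
by rewrite fg linearZ normrZ normfV normr_id ler_pdivrMl// mulrC.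
Qed.

Lemma opnorm_ge0 f : bounded_ops f -> 0 <= opnorm f.
Proof.
move=> /opnorm_supremum[ub _]; apply: (le_trans (normr_ge0 (f 0))).
by apply: ub; exists 0 => //=; rewrite normr0.
Qed.

Lemma opnorm_le f C : bounded_ops f ->
  (forall x, `|x| <= 1 -> `|f x| <= C) -> opnorm f <= C.
Proof.
move=> bf fC; have [_] := opnorm_supremum bf; apply => _ [x x1 <-].
exact: fC.
Qed.

End OperatorNorm.

(** * From weak to norm continuity of linear maps *)

Section WeaklyContinuous.
Variables (K : numFieldType) (hK : real_or_complex K).
Variables (E : completeNormedModType K) (F : normedModType K).

(* If S is unbounded then every set {z | n < |S z|} is dense, and composing S
   with norming functionals shows that it contains balls: nested balls shrink
   to a point where |S| exceeds all integers. *)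
Lemma weakly_continuous_continuous (S : {linear E -> F}) :
  (forall g : {linear F -> K^o}, continuous g -> continuous (g \o S)) ->
  continuous S.
Proof.
move=> wS; apply/linear_bounded_continuous; apply: contrapT => nS.
have unbS (M : K) : 0 <= M -> exists2 u, `|u| <= 1 & M < `|S u|.
  move=> M0; apply: contrapT => nu; apply: nS.
  apply/linear_bounded_continuous/continuous_linear_bound.
  exists (M + 1) => [|x]; first by rewrite ltr_wpDl.
  have [->|x0] := eqVneq x 0; first by rewrite raddf0 !normr0 mulr0.
  have nx : 0 < `|x| by rewrite normr_gt0.
  have : `|S (`|x|^-1 *: x)| <= M.
    rewrite real_leNgt ?ger0_real//; apply/negP => h; apply: nu.
    exists (`|x|^-1 *: x) => //.
    by rewrite normrZ normfV normr_id mulVf ?gt_eqF.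
  rewrite linearZ normrZ normfV normr_id ler_pdivrMl// mulrC => h.
  by rewrite (le_trans h)// ler_wpM2r// lerDl.
(* A pair encodes a ball by centre and radius. With [0 < b.2] as a premise, [choice] yields a total
   step function. *)
pose P (n : nat) (b c : E * K) := 0 < b.2 -> 0 < c.2 /\
  forall z, `|z - c.1| < c.2 ->
    [/\ `|z - b.1| < b.2 / 2, n%:R < `|S z| & `|z - c.1| < n.+1%:R^-1].
have step (nb : nat * (E * K)) : exists c, P nb.1 nb.2 c.
  case: nb => n [x r]; rewrite /P /=.
  have [r0|] := pselect (0 < r); last by exists (x, r).
  have r40 : 0 < r / 4 by rewrite divr_gt0.
  (* The bound makes [(r / 4) *: S u] longer than [n] plus the norm of [S x], so [S y] stays longer
     than [n]. *)
  have [|u u1 Su] := unbS ((n%:R + `|S x|) / (r / 4)).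
    by rewrite divr_ge0 ?addr_ge0// ltW.
  pose y := x + (r / 4) *: u.
  have ySn : n%:R < `|S y|.
    rewrite linearD linearZ/= addrC -(opprK (S x)).
    apply: lt_le_trans (lerB_dist _ _).
    by rewrite normrN normrZ gtr0_norm// ltrBrDr mulrC -ltr_pdivrMr.
  have yx : `|x - y| < r / 2.
    rewrite opprD addNKr normrN normrZ gtr0_norm//.
    apply: (@le_lt_trans _ _ (r / 4)).
      by rewrite -[leRHS]mulr1 ler_wpM2l// ltW.
    by rewrite ltr_pM2l// ltf_pV2 ?posrE// ltr_nat.
  (* The modulus of [g (S z)] bounds the norm of [S z] from below and exceeds [n] at [y], hence near
     [y] by continuity of [g \o S]. *)
  have [g gle gy] := norming_functional hK (S y).
  have cg : continuous g.
    by apply/continuous_linear_bound; exists 1 => // v; rewrite mul1r.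
  have /cvgrPdist_lt gS := wS g cg y.
  have : \forall z \near y,
      [/\ `|z - x| < r / 2, n%:R < `|S z| & `|z - y| < n.+1%:R^-1].
    near=> z; split.
    - rewrite distrC -(subrKA y) (le_lt_trans (ler_normD _ _))// -ltrBrDl.
      by near: z; apply: cvgr_dist_lt => //; rewrite subr_gt0.
    - apply: lt_le_trans (gle (S z)).
      have h : `|g (S y) - g (S z)| < `|g (S y)| - n%:R.
        by near: z; apply: gS; rewrite subr_gt0 gy.
      by have := le_lt_trans (lerB_dist _ _) h; rewrite ltrD2l ltrN2.
    - by rewrite distrC; near: z; apply: cvgr_dist_lt => //; rewrite invr_gt0.
  move=> /nbhs_normP[e /= e0 ye]; exists (y, e) => _; split=> // z zy.
  by apply: ye; rewrite /= distrC.
have [f Pf] := choice step.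
pose fix b n := if n is m.+1 then f (m, b m) else (0, 1).
have b0 n : 0 < (b n).2.
  by elim: n => [|n IH]; [exact: ltr01|have [] := Pf (n, b n) IH].
have bS n z : `|z - (b n.+1).1| < (b n.+1).2 ->
    [/\ `|z - (b n).1| < (b n).2 / 2, n%:R < `|S z|
      & `|z - (b n.+1).1| < n.+1%:R^-1].
  by have [_] := Pf (n, b n) (b0 n); apply.
have half n z : `|z - (b n).1| < (b n).2 / 2 -> `|z - (b n).1| < (b n).2.
  by move=> /lt_trans; apply; rewrite ltr_pdivrMr// ltr_pMr// ltr1n.
have nest m n z :
    (n <= m)%N -> `|z - (b m).1| < (b m).2 -> `|z - (b n).1| < (b n).2.
  move=> /subnK <-; elim: (m - n)%N => [//|k IH] zk; apply: IH.
  by have [/half] := bS _ _ zk.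
have bb m n : (n <= m)%N -> `|(b m).1 - (b n).1| < (b n).2.
  by move=> nm; apply: nest nm _; rewrite subrr normr0.
have : cauchy ((fun n => (b n).1) @ \oo).
  apply: cauchy_exP => e e0.
  have [|n ne] := scalar_archimedean hK (x := e^-1).
    by rewrite invr_ge0 ltW.
  have n0 : (0 : K) < n.+1%:R by [].
  exists (b n.+1).1, n.+1 => // m /= nm; rewrite -ball_normE /= distrC.
  have [_ _ h] := bS n _ (bb _ _ nm); apply: lt_trans h _.
  rewrite -[e]invrK ltf_pV2 ?posrE ?invr_gt0// (lt_trans ne)//.
  by rewrite ltr_nat.
move=> /cauchy_cvg /cvg_ex[l bl].
(* The halved radii keep the limit strictly inside ball [n.+1]: from stage [n.+2] on, the centres
   lie within half its radius. *)
have Sl n : n%:R < `|S l|.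
  suff : `|l - (b n.+1).1| < (b n.+1).2 by move=> /bS[].
  have b2 : 0 < (b n.+1).2 / 2 by rewrite divr_gt0.
  have /cvgrPdist_lt/(_ _ b2)[N _ Nl] := bl.
  pose m := maxn N n.+2; have nm : (n.+2 <= m)%N by rewrite leq_maxr.
  have /(bS n.+1)[h _ _] : `|(b m).1 - (b n.+2).1| < (b n.+2).2 by exact: bb.
  have := Nl m (leq_maxl _ _); move=> /= lm.
  rewrite (splitr (b n.+1).2) -(subrKA (b m).1).
  by rewrite (le_lt_trans (ler_normD _ _))// ltrD.
have [|n] := scalar_archimedean hK (x := `|S l|); first exact: normr_ge0.
by move=> /lt_trans/(_ (Sl n)); rewrite ltxx.
Unshelve. all: by end_near. Qed.

End WeaklyContinuous.

(** * Functionals, rank one operators and standard subalgebras *)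

Lemma exists_functional_eq1 (K : numFieldType) (hK : real_or_complex K)
    (E : normedModType K) (x : E) : x != 0 ->
  exists2 f : {linear E -> K^o}, continuous f & f x = 1.
Proof.
move=> x0; have [g gle gx] := norming_functional hK x.
have gx0 : g x != 0 by rewrite -normr_eq0 gx normr_eq0.
have lf : linear ((fun v => (g x)^-1 * g v) : E -> K^o).
  by move=> a u v; rewrite linearP /= mulrDr mulrCA.
pose f : {linear E -> K^o} := HB.pack (fun v : E => (g x)^-1 * g v)
  (GRing.isLinear.Build _ _ _ _ _ lf).
exists f; last by rewrite /= mulVf.
apply/continuous_linear_bound; exists `|(g x)^-1| => [|v].
  by rewrite normr_gt0 invr_eq0.
by rewrite /= normrM ler_wpM2l.
Qed.

Section RankOne.
Variables (K : numFieldType) (E : completeNormedModType K).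

Definition rank_one (x : E) (f : E -> K) : E -> E := fun v => f v *: x.

Lemma comp_rank_one (a : {linear E -> E}) x f :
  a \o rank_one x f = rank_one (a x) f.
Proof. by apply/funext => v; rewrite /rank_one /= linearZ. Qed.

Lemma rank_oneP (c : K) x y f :
  rank_one (c *: x + y) f = c *: rank_one x f + rank_one y f.
Proof.
apply/funext => v.
by rewrite /rank_one /= scalerDr !scalerA mulrC fctE /= -scalerA.
Qed.

Lemma rank_one_idempotent x (f : {linear E -> K^o}) : f x = 1 ->
  rank_one x f \o rank_one x f = rank_one x f.
Proof.
move=> fx; apply/funext => v.
by rewrite /rank_one /= linearZ /= fx /GRing.scale /= mulr1.
Qed.

Lemma rank_one_bounded x (f : {linear E -> K^o}) : continuous f ->
  bounded_ops (rank_one x f).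
Proof.
move=> cf.
have lr : linear (rank_one x f).
  by move=> a u v; rewrite /rank_one linearP /= scalerDl scalerA.
split=> //; pose r : {linear E -> E} := HB.pack (rank_one x f)
  (GRing.isLinear.Build _ _ _ _ _ lr).
have /continuous_linear_bound[C C0 fC] := cf.
suff : continuous r by [].
apply/continuous_linear_bound; exists (C * (`|x| + 1)) => [|v].
  by rewrite mulr_gt0// ltr_wpDl.
rewrite /= /rank_one normrZ mulrAC ler_pM//.
by rewrite lerDl.
Qed.

(** Allows [g \o S] to be proved continuous by recognising one of its rank one operators as a member
    of a standard algebra. *)
Lemma functional_continuous x (f : {linear E -> K^o}) : x != 0 ->
  bounded_ops (rank_one x f) -> continuous f.
Proof.
move=> x0 /bounded_ops_bound[C C0 fC].
have nx : 0 < `|x| by rewrite normr_gt0.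
apply/continuous_linear_bound; exists (C / `|x|) => [|v].
  by rewrite divr_gt0.
by have := fC v; rewrite /rank_one normrZ -ler_pdivlMr// mulrAC.
Qed.

End RankOne.

Section StandardSubalgebra.
Variables (K : numFieldType) (E : completeNormedModType K).
Variable A : set (E -> E).
Hypothesis hA : standard_subalgebra A.

Lemma standard_bounded f : A f -> bounded_ops f.
Proof. by case: hA => -[bA _ _ _] _ _ /bA. Qed.

Lemma standard_id : A idfun.
Proof. by case: hA. Qed.

Lemma standard_linear f : A f -> exists g : {linear E -> E}, f = g.
Proof. by move=> /standard_bounded/bounded_opsP[g fg _]; exists g. Qed.

Lemma standard_comp f g : A f -> A g -> A (f \o g).
Proof. by case: hA => -[_ _ _ +] _ _; apply. Qed.

Lemma standard_sub f g : A f -> A g -> A (f - g).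
Proof.
by case: hA => -[_ _ lA _] _ _ Af Ag; rewrite addrC -scaleN1r; exact: lA.
Qed.

Lemma standard_rank_one x (f : {linear E -> K^o}) :
  continuous f -> A (rank_one x f).
Proof.
case: hA => _ finA _ cf; apply: finA; first exact: rank_one_bounded.
exists 1%N, (fun _ => x) => v; exists (fun _ => f v).
by rewrite big_ord1.
Qed.

End StandardSubalgebra.

(** * Moving rank one operators across products of images *)

Section Separating.
Variables (K : numFieldType) (E1 E2 : completeNormedModType K).
Variables (A1 : set (E1 -> E1)) (A2 : set (E2 -> E2)).
Hypotheses (hA1 : standard_subalgebra A1) (hA2 : standard_subalgebra A2).
Variable T : (E1 -> E1) -> (E2 -> E2).
Hypothesis sT : separating A1 A2 T.

Lemma separatingB f g : A1 f -> A1 g -> T (f - g) = T f - T g.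
Proof.
have [_ Tlin _] := sT => Af Ag.
by rewrite addrC -scaleN1r Tlin// scaleN1r addrC.
Qed.

Lemma separating0 : T 0 = 0.
Proof.
have A1id := standard_id hA1.
by rewrite -(subrr (idfun : E1 -> E1)) separatingB// subrr.
Qed.

(* The operators b that can be moved across a product of images; they contain
   the idempotents, since [ab(c - bc) = 0 = (a - ab)bc] when [bb = b]. *)
Definition transferable (b : E1 -> E1) : Prop :=
  forall a c, A1 a -> A1 c -> T (a \o b) \o T c = T a \o T (b \o c).

Lemma idempotent_transferable p : A1 p -> p \o p = p -> transferable p.
Proof.
move=> Ap pp a c Aa Ac; have [TA Tlin Tsep] := sT.
have Aap := standard_comp hA1 Aa Ap; have Apc := standard_comp hA1 Ap Ac.
have [a' aE] := standard_linear hA1 Aa; have [p' pE] := standard_linear hA1 Ap.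
have ppE v : p (p v) = p v := congr1 (@^~ v) pp.
have Acpc := standard_sub hA1 Ac Apc.
have Aaap := standard_sub hA1 Aa Aap.
have h1 : (a \o p) \o (c - (p \o c)) = 0.
  apply/funext => v; rewrite /= !fctE /= aE pE linearB /= -pE ppE subrr.
  by rewrite raddf0.
have h2 : (a - (a \o p)) \o (p \o c) = 0.
  by apply/funext => v; rewrite /= !fctE /= ppE subrr.
have /(congr1 (@^~ _)) T1 := Tsep _ _ Aap Acpc h1.
have /(congr1 (@^~ _)) T2 := Tsep _ _ Aaap Apc h2.
have [ap apE] := standard_linear hA2 (TA _ Aap).
apply/funext => v; have := T1 v; have := T2 v.
rewrite !separatingB//= !fctE /= apE linearB /=.
move=> /eqP; rewrite subr_eq0 => /eqP <-.
by move=> /eqP; rewrite subr_eq0 => /eqP.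
Qed.

Lemma transferable_lin (s : K) p q : A1 p -> A1 q ->
  transferable p -> transferable q -> transferable (s *: p + q).
Proof.
move=> Ap Aq tp tq a c Aa Ac; have [TA Tlin _] := sT.
have [a' aE] := standard_linear hA1 Aa.
have [Ta TaE] := standard_linear hA2 (TA _ Aa).
have -> : a \o (s *: p + q) = s *: (a \o p) + (a \o q).
  by apply/funext => v; rewrite /= !fctE /= aE linearP.
have -> : (s *: p + q) \o c = s *: (p \o c) + (q \o c) by [].
rewrite !Tlin; try exact: standard_comp.
apply/funext => v; rewrite /= !fctE /= TaE linearP -TaE /=.
congr (_ *: _ + _).
  exact: (congr1 (@^~ v) (tp a c Aa Ac)).
exact: (congr1 (@^~ v) (tq a c Aa Ac)).
Qed.

(** If [f] is nonzero, [x] is a combination of two vectors [y1] and [x1] at which [f] is 1, and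
    these give idempotents. If [f] is zero, both products vanish. *)
Lemma rank_one_transferable x (f : {linear E1 -> K^o}) : continuous f ->
  transferable (rank_one x f).
Proof.
move=> cf; have rA y := standard_rank_one hA1 y cf.
have [[y fy]|nf] := pselect (exists y, f y != 0); last first.
  have -> : rank_one x f = 0.
    apply/funext => v; rewrite /rank_one; have [->|fv] := eqVneq (f v) 0.
      by rewrite scale0r.
    by case: nf; exists v.
  move=> a c Aa Ac; have [TA _ _] := sT.
  have [a' aE] := standard_linear hA1 Aa.
  have [Ta TaE] := standard_linear hA2 (TA _ Aa).
  have -> : a \o 0 = 0 :> (E1 -> E1) by apply/funext => v; rewrite /= aE raddf0.
  have -> : 0 \o c = 0 :> (E1 -> E1) by [].
  by rewrite separating0 TaE; apply/funext => v; rewrite /= raddf0.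
pose y1 := (f y)^-1 *: y.
have fy1 : f y1 = 1 by rewrite linearZ /= /GRing.scale /= mulVf.
pose x1 := x + (1 - f x) *: y1.
have fx1 : f x1 = 1.
  by rewrite linearD linearZ /= fy1 /GRing.scale /= mulr1 addrC subrK.
have -> : rank_one x f = (f x - 1) *: rank_one y1 f + rank_one x1 f.
  by rewrite -rank_oneP /x1 addrCA -scalerDl addrA subrK subrr scale0r addr0.
by apply: transferable_lin => //; apply: idempotent_transferable => //;
   exact: rank_one_idempotent.
Qed.

End Separating.

(** [T f = 0] would give [f = U 0 = 0]. Applied in both directions to find vectors that an image
    does not kill. *)
Lemma separating_neq0 (K : numFieldType) (E1 E2 : completeNormedModType K)
    (A1 : set (E1 -> E1)) (A2 : set (E2 -> E2)) T U f x :
  standard_subalgebra A2 -> separating A2 A1 U ->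
  (forall f, A1 f -> U (T f) = f) -> A1 f -> f x != 0 -> exists y, T f y != 0.
Proof.
move=> hA2 sU TK Af fx; apply: contrapT => nT; move/eqP: fx; apply.
have Tf0 : T f = 0.
  by apply/funext => y; apply/eqP/negPn/negP => Tfy; apply: nT; exists y.
by rewrite -(TK f Af) Tf0 (separating0 hA2 sU).
Qed.

(** * The form of a biseparating map *)

Section Biseparating.
Variables (K : numFieldType) (hK : real_or_complex K).
Variables (E1 E2 : completeNormedModType K).
Variables (A1 : set (E1 -> E1)) (A2 : set (E2 -> E2)).
Hypotheses (hA1 : standard_subalgebra A1) (hA2 : standard_subalgebra A2).
Variables (T : (E1 -> E1) -> (E2 -> E2)) (U : (E2 -> E2) -> (E1 -> E1)).
Hypotheses (sT : separating A1 A2 T) (sU : separating A2 A1 U).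
Hypotheses (TK : forall f, A1 f -> U (T f) = f).
Hypotheses (UK : forall g, A2 g -> T (U g) = g).

Lemma image_linear f : A1 f -> exists g : {linear E2 -> E2}, T f = g.
Proof. by have [TA _ _] := sT => /TA; exact: standard_linear. Qed.

Lemma domain_nontrivial (y : E2) : y != 0 -> exists x : E1, x != 0.
Proof.
move=> y0; have A2id := standard_id hA2.
have [x Ux] := separating_neq0 hA1 sT UK A2id y0.
by exists (U idfun x).
Qed.

Lemma mul_image_rank_one x (f : {linear E1 -> K^o}) c : continuous f -> A1 c ->
  T (rank_one x f) \o T c = T idfun \o T (rank_one x f \o c).
Proof.
by move=> cf Ac; have A1id := standard_id hA1;
  exact: (rank_one_transferable hA1 hA2 sT x cf A1id Ac).
Qed.

Lemma image_rank_one_mul x (f : {linear E1 -> K^o}) a : continuous f -> A1 a ->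
  T (a \o rank_one x f) \o T idfun = T a \o T (rank_one x f).
Proof.
by move=> cf Aa; have A1id := standard_id hA1;
  exact: (rank_one_transferable hA1 hA2 sT x cf Aa A1id).
Qed.

(* [T id] commutes with the images of rank one operators and, since
   [T a T b T c = (T id)^2 T(abc)] for [b] rank one, with every [y (x) g]:
   these have the form [T a T b T c] with [b] fixed. *)
Lemma image_id_scalar (y0 : E2) : y0 != 0 ->
  exists2 alpha : K, alpha != 0 & forall y, T idfun y = alpha *: y.
Proof.
move=> y00; pose e := T idfun; have A1id := standard_id hA1.
have [TA _ _] := sT.
have [UA _ _] := sU.
have [x1 x10] := domain_nontrivial y00.
have [f cf fx1] := exists_functional_eq1 hK x10.
pose b := rank_one x1 f; have Ab : A1 b by exact: standard_rank_one.
have [z tz] : exists z, T b z != 0.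
  apply: (separating_neq0 (x := x1) hA2 sU TK Ab).
  by rewrite /b /rank_one fx1 scale1r.
have [h ch htz] := exists_functional_eq1 hK tz.
have factor y (g : {linear E2 -> K^o}) : continuous g ->
    exists2 d, A1 d & rank_one y g = e \o (e \o T d) /\ e \o T d = T d \o e.
  move=> cg; have Ayh := standard_rank_one hA2 y ch.
  have Azg := standard_rank_one hA2 z cg.
  (* As [h (T b z) = 1], the product of [T a], [T b] and [T c] is [rank_one y g]. *)
  pose a := U (rank_one y h); pose c := U (rank_one z g).
  have Aa : A1 a by exact: UA. have Ac : A1 c by exact: UA.
  have Aab : A1 (a \o b) by exact: standard_comp.
  have [a' aE] := standard_linear hA1 Aa.
  have [c' cE] := standard_linear hA1 Ac.
  have abE : a \o b = rank_one (a x1) f by rewrite aE comp_rank_one.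
  have Aabc : A1 (a \o b \o c) by exact: standard_comp.
  exists (a \o b \o c) => //; split.
    have -> : rank_one y g = T a \o T b \o T c.
      rewrite !UK//; apply/funext => v; rewrite /rank_one /=.
      have [Tb TbE] := image_linear Ab.
      by rewrite TbE linearZ -TbE /= linearZ /= htz /GRing.scale /= mulr1.
    (* [T a \o T b] is [T (a \o b) \o e]; then [e] moves left past [T (a \o b)], and
       [T (a \o b) \o T c] releases a second [e]. *)
    rewrite -(image_rank_one_mul x1 cf Aa).
    have := mul_image_rank_one (a x1) cf A1id.
    have := image_rank_one_mul (a x1) cf A1id.
    have := mul_image_rank_one (a x1) cf Ac.
    rewrite -abE => h1 h2 h3.
    have comm v : T (a \o b) (e v) = e (T (a \o b) v).
      exact: (congr1 (@^~ v) h3).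
    apply/funext => v; rewrite /= comm; congr (e _).
    exact: (congr1 (@^~ v) h1).
  have cfc : continuous (f \o c').
    have [_ cc] := standard_bounded hA1 Ac; rewrite cE in cc.
    by move=> v; apply: continuous_comp; [exact: cc|exact: cf].
  have -> : a \o b \o c = rank_one (a x1) (f \o c') by rewrite abE cE.
  have := mul_image_rank_one (a x1) cfc A1id.
  by have := image_rank_one_mul (a x1) cfc A1id.
have [k ck ky0] := exists_functional_eq1 hK y00.
(* By [factor], [e] commutes with [rank_one y k]; both products are evaluated at [y0]. *)
have ecomm y : e (k y0 *: y) = k (e y0) *: y.
  have [d Ad [dE ed]] := factor y k ck.
  have edv v : e (T d v) = T d (e v) by exact: (congr1 (@^~ v) ed).
  have dEv v : k v *: y = e (e (T d v)) by exact: (congr1 (@^~ v) dE).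
  by rewrite !dEv !edv.
have eZ y : e y = k (e y0) *: y by rewrite -ecomm ky0 scale1r.
exists (k (e y0)) => //; apply/eqP => alpha0.
(* A zero scalar would make [e], and with it [rank_one y0 k], vanish, yet the latter fixes [y0]. *)
have [d Ad [dE _]] := factor y0 k ck.
have := congr1 (@^~ y0) dE; rewrite /rank_one /= ky0 scale1r eZ alpha0 scale0r.
by move/eqP; rewrite (negbTE y00).
Qed.

Lemma biseparating_form :
  exists (alpha : K) (S : {linear E1 -> E2}) (S' : {linear E2 -> E1}),
    [/\ alpha != 0,
        cancel S S' /\ cancel S' S,
        continuous S /\ continuous S'
      & forall a : E1 -> E1, A1 a -> T a = alpha *: (S \o a \o S')].
Proof.
have [TA Tlin _] := sT; have [UA _ _] := sU.
(* If [E2] is zero, then the identity of [E1] is [U 0 = 0], so [E1] is zero too and zero maps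
   serve. *)
have [[y0 y00]|E20] := pselect (exists y0 : E2, y0 != 0); last first.
  have y0 (y : E2) : y = 0 by apply/eqP/negPn/negP => y0; apply: E20; exists y.
  have A1id := standard_id hA1.
  have id0 : idfun = 0 :> (E1 -> E1).
    rewrite -(TK A1id) -(separating0 hA2 sU); congr (U _).
    by apply/funext => y; rewrite [LHS]y0 [RHS]y0.
  have x0 (x : E1) : x = 0 by exact: (congr1 (@^~ x) id0).
  exists 1, \0, \0; split; first exact: oner_neq0.
  - by split=> x /=; rewrite [RHS]x0 || rewrite [RHS]y0.
  - by split=> x; exact: cvg_cst.
  - by move=> a _; apply/funext => y; rewrite [LHS]y0 [RHS]y0.
have [alpha alpha0 eE] := image_id_scalar y00.
have TM x (f : {linear E1 -> K^o}) a v : continuous f -> A1 a ->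
    T a (T (rank_one x f) v) = alpha *: T (a \o rank_one x f) v.
  move=> cf Aa; have [a' aE] := standard_linear hA1 Aa.
  have := congr1 (@^~ v) (image_rank_one_mul x cf Aa).
  rewrite /= eE => <-.
  have Aax : A1 (a \o rank_one x f).
    by apply: standard_comp => //; exact: standard_rank_one.
  by have [g ->] := image_linear Aax; rewrite linearZ.
have [u0 u00] := domain_nontrivial y00.
have [f cf fu0] := exists_functional_eq1 hK u00.
have rA x := standard_rank_one hA1 x cf.
pose p := rank_one u0 f.
have [w' w'0] : exists w', T p w' != 0.
  apply: (separating_neq0 (x := u0) hA2 sU TK (rA u0)).
  by rewrite /rank_one fu0 scale1r.
(* Taking [w] in the range of [T p] with [p] idempotent gives [T p w = alpha *: w], so [S u0] is
   nonzero. *)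
pose w := T p w'.
have pw : T p w = alpha *: w.
  by rewrite /w TM ?rank_one_idempotent//; exact: rA.
have [S SE] : exists S : {linear E1 -> E2}, forall x, S x = T (rank_one x f) w.
  pose S0 x := T (rank_one x f) w.
  have lS : linear S0 by move=> s x y; rewrite /S0 rank_oneP Tlin.
  by exists (HB.pack_for {linear E1 -> E2} S0
    (GRing.isLinear.Build _ _ _ _ _ lS)).
have TS a x : A1 a -> T a (S x) = alpha *: S (a x).
  move=> Aa; rewrite !SE TM//.
  by have [a' ->] := standard_linear hA1 Aa; rewrite comp_rank_one.
have Su0 : S u0 = alpha *: w by rewrite SE.
(* If [S x = 0] and [g x = 1], then [T (rank_one u0 g)] sends [S x] to [alpha *: S u0], which is
   nonzero. *)
have Sinj : injective S.
  apply: raddf_inj => x Sx0; apply/eqP/negPn/negP => x0.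
  have [g cg gx] := exists_functional_eq1 hK x0.
  have Ag := standard_rank_one hA1 u0 cg.
  have := TS _ x Ag; rewrite Sx0 {2}/rank_one gx scale1r Su0.
  have [t ->] := image_linear Ag; rewrite linear0 => /esym/eqP.
  by rewrite !scaler_eq0 (negbTE alpha0) (negbTE w'0).
have Ssurj y : exists x, S x = y.
  have [g cg gw] := exists_functional_eq1 hK w'0.
  have Ag := standard_rank_one hA2 y cg.
  (* [rank_one y g] sends [S u0 = alpha *: w] to [alpha *: y], and [TS] turns this into the value of
     [S] at the witness. *)
  exists (U (rank_one y g) u0); apply: (scalerI alpha0).
  rewrite -TS; last exact: UA.
  by rewrite UK// Su0 /rank_one linearZ /= [g w]gw /GRing.scale /= mulr1.
have [S0' S0'K] := choice Ssurj.
have lS' : linear S0'.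
  by move=> s x y; apply: Sinj; rewrite linearP !S0'K.
have [S' S'K] : exists S' : {linear E2 -> E1}, cancel S' S.
  by exists (HB.pack_for {linear E2 -> E1} S0'
    (GRing.isLinear.Build _ _ _ _ _ lS')).
have SK : cancel S S' by move=> x; apply: Sinj; rewrite S'K.
have Tform a : A1 a -> T a = alpha *: (S \o a \o S').
  by move=> Aa; apply/funext => y; rewrite -[in LHS](S'K y) TS.
have cS : continuous S.
  apply: (weakly_continuous_continuous hK) => g cg.
  pose c := U (rank_one y0 g); have Ag := standard_rank_one hA2 y0 cg.
  have Ac : A1 c by exact: UA.
  (* The vector is read off from [U (rank_one y0 g)], which [Tform] forces to be the conjugate of
     [rank_one y0 g] by [S], divided by [alpha]. *)
  apply: (@functional_continuous _ _ (alpha^-1 *: S' y0)).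
    rewrite scaler_eq0 invr_eq0 (negbTE alpha0)/=.
    apply: contra y00 => /eqP S'y0.
    by rewrite -(S'K y0) S'y0 linear0.
  suff -> : rank_one (alpha^-1 *: S' y0) (g \o S) = c.
    exact: (standard_bounded hA1).
  apply/funext => x; apply: Sinj; apply: (scalerI alpha0).
  rewrite -[RHS]TS// /c UK// /rank_one.
  rewrite [S (_ *: _)]linearZ [S (_ *: _)]linearZ /= S'K.
  by rewrite !scalerA mulrCA mulfV// mulr1.
have cS' : continuous S'.
  apply: (weakly_continuous_continuous hK) => g cg.
  have Ag := standard_rank_one hA1 u0 cg.
  apply: (@functional_continuous _ _ (alpha *: S u0)).
    rewrite scaler_eq0 (negbTE alpha0)/=; apply: contra u00 => /eqP Su.
    by rewrite -(SK u0) Su (linear0 S').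
  suff -> : rank_one (alpha *: S u0) (g \o S') = T (rank_one u0 g).
    by apply: (standard_bounded hA2); exact: TA.
  apply/funext => y; rewrite Tform//.
  transitivity (alpha *: S (g (S' y) *: u0)); last by [].
  by rewrite linearZ /rank_one /= !scalerA mulrC.
by exists alpha, S, S'.
Qed.

End Biseparating.

(** * Continuity of [T] deduced from its form *)

Theorem theorem1 (K : numFieldType) (hK : real_or_complex K)
    (E1 E2 : completeNormedModType K)
    (A1 : set (E1 -> E1)) (A2 : set (E2 -> E2))
    (hA1 : standard_subalgebra A1) (hA2 : standard_subalgebra A2)
    (T : (E1 -> E1) -> (E2 -> E2)) (hT : biseparating A1 A2 T) :
  opnorm_continuous A1 T /\
  exists (alpha : K) (S : {linear E1 -> E2}) (Sinv : {linear E2 -> E1}),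
    [/\ alpha != 0,
        cancel S Sinv /\ cancel Sinv S,
        continuous S /\ continuous Sinv
      & forall A : E1 -> E1, A1 A -> T A = alpha *: (S \o A \o Sinv)].
Proof.
have [sT [U [TK UK sU]]] := hT.
have form := biseparating_form hK hA1 hA2 sT sU TK UK.
split=> //; have [alpha [S [S' [alpha0 _ [cS cS'] Tform]]]] := form.
have [TA _ _] := sT.
have [C C0 SC] := (continuous_linear_bound S).1 cS.
have [C' C'0 S'C] := (continuous_linear_bound S').1 cS'.
(* A Lipschitz constant for [T], from bounding the three factors of [alpha *: (S \o h \o S')]
   separately. *)
pose M := `|alpha| * C * C'.
have M0 : 0 < M by rewrite !mulr_gt0// normr_gt0.
move=> f Af d d0; exists (d / M) => [|g Ag]; first by rewrite divr_gt0.
have Ah := standard_sub hA1 Ag Af; have bh := standard_bounded hA1 Ah.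
rewrite ltr_pdivlMr// mulrC; apply: le_lt_trans.
rewrite -(separatingB sT)//.
apply: opnorm_le => //; first by apply: (standard_bounded hA2); exact: TA.
move=> y y1; rewrite Tform// fctE /= normrZ -!mulrA ler_wpM2l//.
apply: le_trans (SC _) _; rewrite (ler_wpM2l (ltW C0))// [leRHS]mulrC.
apply: le_trans (opnorm_bound hK _ bh) _.
rewrite ler_wpM2l ?opnorm_ge0//.
by rewrite (le_trans (S'C y))// -[leRHS]mulr1 ler_wpM2l// ltW.
Qed.
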